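(* Let $x,t,\lambda$ be real numbers with $t\ge 0$ and $\lambda>0$. Then for every integer $k\ge 0$, $k!\,P_k(x-\lambda t,\,x,\,x,\ldots)=\widetilde{C}_k(x,\lambda t)$, where $P_k$ is the $k$-th Kailath-Segall polynomial and $\widetilde{C}_k$ is the $k$-th Poisson-Charlier polynomial.
   Context: The Kailath-Segall polynomials $P_n(x_1,\ldots,x_n)$ in the indeterminates $x_1,x_2,\ldots$ are defined by $P_0=1$ and, for $n\ge 1$, by the recursion $P_n=\frac1n\left(P_{n-1}x_1-P_{n-2}x_2+\cdots+(-1)^{n+1}P_0x_n\right)$, where $P_j$ abbreviates $P_j(x_1,\ldots,x_j)$. Equivalently, as formal power series, $\sum_{n\ge 0}P_n(x_1,\ldots,x_n)z^n=\exp\left(\sum_{n\ge 1}\frac{(-1)^{n+1}}{n}x_nz^n\right)$. For $P_k(x-\lambda t,x,x,\ldots)$ one substitutes $x_1=x-\lambda t$ and $x_i=x$ for $i\ge 2$ (only the first $k$ of these values are used). The Poisson-Charlier polynomials $\widetilde{C}_k(x,t)$ are defined by the generating function $\sum_{k\ge 0}\widetilde{C}_k(x,t)\frac{z^k}{k!}=e^{-tz}(1+z)^x$. *)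

(* Defs.v *)
From mathcomp Require Import all_boot all_order all_algebra.
From mathcomp Require Import finmap.
From mathcomp Require Import all_classical all_reals all_analysis.
From mathcomp Require Import -(notations) monalg.

Set Implicit Arguments.
Unset Strict Implicit.
Unset Printing Implicit Defensive.

Import Order.TTheory GRing.Theory Num.Theory.
Import numFieldNormedType.Exports.

Local Open Scope classical_set_scope.
Local Open Scope ring_scope.

(* Polynomials over F in the countably many indeterminates x_0, x_1, x_2, ...;
   x_0 is never used below, so that indices agree with the usual ones. *)
Notation infpoly F := (malg (cmonom nat) F).

Definition indet (F : fieldType) (i : nat) : infpoly F :=
  mkmalgU (ucm i) 1.

(* The substitution x_i := v i, extended to all polynomials. *)
Definition infpoly_eval (F : fieldType) (v : nat -> F) (p : infpoly F) : F :=
  mmap idfun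
    (fun m : cmonom nat =>
       \prod_(i <- finsupp (cmonom_val m)) v i ^+ cmonom_val m i)
    p.

(* The list [:: P_n; P_(n-1); ...; P_0]; the defining recursion is recovered in
   kailath_segall0 and kailath_segallS (the sign is (-1)^i because the term with
   index i involves x_(i+1)). *)
Fixpoint kailath_segall_rev (F : fieldType) (n : nat) : seq (infpoly F) :=
  if n is m.+1 then
    let s := kailath_segall_rev F m in
    (m.+1%:R^-1 *: \sum_(i < m.+1) (-1) ^+ i *: (s`_i * indet F i.+1)) :: s
  else [:: 1].

Definition kailath_segall (F : fieldType) (n : nat) : infpoly F :=
  (kailath_segall_rev F n)`_0.

Lemma kailath_segall0 (F : fieldType) : kailath_segall F 0 = 1.
Proof. reflexivity. Qed.

Lemma kailath_segall_revE (F : fieldType) (n i : nat) :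
  (i <= n)%N -> (kailath_segall_rev F n)`_i = kailath_segall F (n - i).
Proof.
elim: n i => [|n IHn] [|i] Hi.
- reflexivity.
- discriminate Hi.
- rewrite subn0; reflexivity.
- exact: IHn.
Qed.

Lemma kailath_segallS (F : fieldType) (n : nat) :
  kailath_segall F n.+1 =
  n.+1%:R^-1 *: \sum_(i < n.+1)
    (-1) ^+ i *: (kailath_segall F (n - i) * indet F i.+1).
Proof.
transitivity (n.+1%:R^-1 *: \sum_(i < n.+1)
    (-1) ^+ i *: ((kailath_segall_rev F n)`_i * indet F i.+1)).
- reflexivity.
apply: (congr1 (fun s => n.+1%:R^-1 *: s)).
apply: eq_bigr => i _.
rewrite kailath_segall_revE.
- reflexivity.
exact: leq_ord.
Qed.

(* sum_k c_k z^k / k! converges to e^(-tz) (1+z)^x for all z near 0. *)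
Definition charlier_gen (R : realType) (x t : R) (c : nat -> R) : Prop :=
  \forall z \near (0 : R),
    pseries (fun k => c k / k`!%:R) z @ \oo --> expR (- t * z) * (1 + z) `^ x.

(* The sequence (C_k(x,t))_k determined by its generating function; by
   uniqueness of power series coefficients at most one sequence qualifies, so
   the default value is only a formal requirement of xget. *)
Definition poisson_charlier (R : realType) (k : nat) (x t : R) : R :=
  xget (fun=> 0) [set c : nat -> R | charlier_gen x t c] k.

(* Main.v *)
Require Import Defs.
From HB Require Import structures.
From mathcomp Require Import all_boot all_order all_algebra.
From mathcomp Require Import finmap.
From mathcomp Require Import all_classical all_reals all_analysis.
From mathcomp Require Import -(notations) monalg.
From mathcomp Require Import ring lra.

(* Put s = lambda t and p_k = P_k(x - s, x, x, ...).  Since x_2 = x_3 = ... = x,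
   adding two consecutive instances of the recursion gives a three-term recursion,
   which says that f(z) = sum_k p_k z^k satisfies
     (1 + z) f'(z) = (x - s - s z) f(z),  f(0) = 1.
   The recursion also bounds p_k geometrically, so f has a positive radius of
   convergence, and f(z) exp(s z - x ln(1 + z)) has zero derivative near 0;
   hence f(z) = exp(-s z) (1 + z)^x.  Uniqueness of power series coefficients then
   identifies k! p_k with the Poisson-Charlier polynomial. *)

Import Order.TTheory GRing.Theory Num.Theory.
Import numFieldNormedType.Exports.

Local Open Scope classical_set_scope.
Local Open Scope ring_scope.

(** * Evaluation of polynomials in countably many indeterminates *)

Section Evaluation.
Context {F : fieldType} (v : nat -> F).

(** Named so that a multiplicative structure can be attached to it; [mmap] along it is then a ring
    morphism. *)
Definition cmonom_eval (m : cmonom nat) : F :=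
  \prod_(i <- finsupp (cmonom_val m)) v i ^+ cmonom_val m i.

(** Enlarging the index set only adds factors with exponent 0. This lets two monomials be evaluated
    over the union of their supports. *)
Lemma cmonom_evalEw (m : cmonom nat) (d : {fset nat}) :
  (finsupp (cmonom_val m) `<=` d)%fset ->
  cmonom_eval m = \prod_(i <- d) v i ^+ cmonom_val m i.
Proof.
move=> le; rewrite /cmonom_eval; apply: big_fset_incl le _ => i _.
by rewrite -cmE_neq0 negbK => /eqP ->; rewrite expr0.
Qed.

Lemma cmonom_eval_is_multiplicative : mmorphism cmonom_eval.
Proof.
split=> [m1 m2|]; last by rewrite /cmonom_eval mdom1 big_seq_fset0.
rewrite (cmonom_evalEw m1 _ (fsubsetUl _ (finsupp (cmonom_val m2)))).
rewrite (cmonom_evalEw m2 _ (fsubsetUr (finsupp (cmonom_val m1)) _)).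
rewrite /cmonom_eval mdomD -big_split /=.
by apply: eq_bigr => i _; rewrite cmM exprD.
Qed.

HB.instance Definition _ :=
  monalg.isMultiplicative.Build _ _ cmonom_eval cmonom_eval_is_multiplicative.

Lemma infpoly_evalE : infpoly_eval v = mmap idfun cmonom_eval.
Proof. by []. Qed.

Lemma infpoly_eval_indet i : infpoly_eval v (indet F i) = v i.
Proof.
rewrite infpoly_evalE mmapU mul1r /cmonom_eval mdomU big_seq_fset1.
by rewrite cmUU expr1.
Qed.

Lemma infpoly_eval_kailath_segall0 : infpoly_eval v (kailath_segall F 0) = 1.
Proof. by rewrite kailath_segall0 infpoly_evalE mmap1. Qed.

Lemma infpoly_eval_kailath_segallS n :
  infpoly_eval v (kailath_segall F n.+1) = n.+1%:R^-1 *
    \sum_(i < n.+1) (-1) ^+ i *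
      (infpoly_eval v (kailath_segall F (n - i)) * v i.+1).
Proof.
rewrite kailath_segallS !infpoly_evalE mmapZ raddf_sum; congr (_ * _).
apply: eq_bigr => i _; rewrite /= mmapZ rmorphM /=; congr (_ * (_ * _)).
exact: infpoly_eval_indet.
Qed.

End Evaluation.

(** * Power series near 0: convergence, differentiation, uniqueness of coefficients *)

Section PowerSeries.
Context {R : realType}.
Implicit Types (c : nat -> R) (x z : R).

Lemma near_cvg_pseries c (B M : R) : (forall k, `|c k| <= B * M ^+ k) ->
  \forall z \near (0 : R), cvgn (pseries c z).
Proof.
move=> cB.
have B0 : 0 <= B by have := cB 0; rewrite expr0 mulr1; apply: le_trans.
have : \forall z \near (0 : R), `|M * z| < 1.
  have : M * z @[z --> 0] --> M * 0.
    by apply: cvgM; [exact: cvg_cst | exact: cvg_id].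
  by rewrite mulr0 => /cvgr0Pnorm_lt; apply.
apply: filterS => z Mz.
apply: normed_cvg; apply: (@series_le_cvg _ _ (geometric B `|M * z|)) => //=.
- by move=> n; rewrite mulr_ge0 ?exprn_ge0.
- move=> n; rewrite !normrM normrX exprMn mulrA.
  rewrite ler_wpM2r ?exprn_ge0//; apply: (le_trans (cB n)).
  by rewrite ler_wpM2l// -normrX ler_norm.
- by apply: is_cvg_geometric_series; rewrite normr_id.
Qed.

Lemma cvg_pseries_bound c K : K != 0 -> cvgn (pseries c K) ->
  exists B, forall k, `|c k| <= B * `|K|^-1 ^+ k.
Proof.
move=> K0 /cvg_series_bounded[B [_ cB]].
exists (B + 1) => k; have := cB (B + 1); rewrite ltrDl ltr01 => /(_ isT k I).
by rewrite /= normrM normrX exprVn -ler_pdivlMr// exprn_gt0// normr_gt0.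
Qed.

Lemma near_cvg_pseries_diffs c :
  (\forall z \near (0 : R), cvgn (pseries c z)) ->
  \forall z \near (0 : R), cvgn (pseries (pseries_diffs c) z).
Proof.
move=> ccvg; have [K K0 cK] : exists2 K : R, K != 0 & cvgn (pseries c K).
  move/nbhs_ballP: ccvg => [e /= e0 he]; exists (e / 2).
    by rewrite mulf_neq0 ?gt_eqF ?invr_gt0.
  apply: he; rewrite /ball /= sub0r normrN gtr0_norm ?divr_gt0//.
  by rewrite ltr_pdivrMr// ltr_pMr// ltr1n.
have [B cB] := cvg_pseries_bound _ _ K0 cK.
(* The factor k + 1 from differentiation is absorbed by k + 1 <= 2^k, and the shift of the index
   costs one factor 1 / |K|. *)
apply: (@near_cvg_pseries _ (B / `|K|) (2 / `|K|)) => k.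
rewrite /pseries_diffs normrM normr_nat exprMn mulrCA.
rewrite (_ : B / _ * _ = B * `|K|^-1 ^+ k.+1); last by rewrite exprS mulrA.
apply: ler_pM => //; rewrite -natrX ler_nat.
exact: ltn_expl.
Qed.

(** Termwise differentiation inside |z| < e / 2 requires convergence at e / 2 of the series and of
    its first two formal derivatives; all three have geometrically bounded coefficients. *)
Lemma near_is_derive_pseries c :
  (\forall z \near (0 : R), cvgn (pseries c z)) ->
  \forall z \near (0 : R), is_derive z (1 : R) (fun x => limn (pseries c x))
    (limn (pseries (pseries_diffs c) z)).
Proof.
move=> c0; have c1 := near_cvg_pseries_diffs _ c0.
have c2 := near_cvg_pseries_diffs _ c1.
have : \forall z \near (0 : R), [/\ cvgn (pseries c z),
    cvgn (pseries (pseries_diffs c) z) &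
    cvgn (pseries (pseries_diffs (pseries_diffs c)) z)].
  by apply: filterS3 c0 c1 c2.
move=> /nbhs_ballP[e /= e0 he].
have e2 : 0 < e / 2 by rewrite divr_gt0.
have [|h0 h1 h2] := he (e / 2).
  rewrite /ball /= sub0r normrN gtr0_norm//.
  by rewrite ltr_pdivrMr// ltr_pMr// ltr1n.
apply/nbhs_ballP; exists (e / 2) => //= z; rewrite /ball /= sub0r normrN => ze.
by apply: pseries_snd_diffs h0 h1 h2 _; rewrite (gtr0_norm e2).
Qed.

Lemma limn_pseries0 c : limn (pseries c 0) = c 0.
Proof.
apply: lim_near_cst => //; near=> n.
rewrite /pseries /series /= -(prednK (_ : 0 < n)%N); last first.
  by near: n; exact: nbhs_infty_gt.
rewrite big_nat_recl//= expr0 mulr1 big1 ?addr0// => i _.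
by rewrite exprS mul0r mulr0.
Unshelve. all: by end_near. Qed.

(** Induction on n over all c: setting z = 0 gives c_0 = 0, and the formal derivative again sums to
    0 near 0, so its n-th coefficient (n + 1) c_(n+1) vanishes. *)
Lemma pseries_eq0 c :
  (\forall z \near (0 : R), pseries c z @ \oo --> (0 : R)) ->
  forall n, c n = 0.
Proof.
move=> + n; elim: n c => [|n IH] c c0.
  rewrite -limn_pseries0; apply: cvg_lim => //; exact: nbhs_singleton c0.
have ccvg : \forall z \near (0 : R), cvgn (pseries c z).
  by apply: filterS c0 => z; exact: cvgP.
have : pseries_diffs c n = 0.
  (* To differentiate at z, the sum must vanish on a whole neighbourhood of z, not just at z. *)
  apply: IH; have /near_join c00 := c0.
  have dcvg := near_cvg_pseries_diffs _ ccvg.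
  have dder := near_is_derive_pseries _ ccvg.
  near=> z.
  have dc : cvgn (pseries (pseries_diffs c) z) by near: z.
  have zd : is_derive z (1 : R) (fun x => limn (pseries c x))
    (limn (pseries (pseries_diffs c) z)) by near: z.
  have z0 : \forall y \near z, limn (pseries c y) = cst 0 y.
    have : \forall y \near z, pseries c y @ \oo --> (0 : R) by near: z.
    by apply: filterS => y; exact: cvg_lim.
  have zd0 : is_derive z (1 : R) (fun x => limn (pseries c x)) 0.
    apply: near_eq_is_derive (is_derive_cst 0 z 1).
    by apply: filterS z0 => y ->.
  suff <- : limn (pseries (pseries_diffs c) z) = 0 by [].
  by case: zd => _ <-; case: zd0.
rewrite /pseries_diffs => /eqP; rewrite mulf_eq0 pnatr_eq0 /= => /eqP.
exact.
Unshelve. all: by end_near. Qed.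

Lemma itv_is_derive0_cst (f : R -> R) (a b : R) : a <= b ->
  (forall y, y \in `[a, b] -> is_derive y (1 : R) f 0) -> f a = f b.
Proof.
move=> ab fd.
have fd' y : y \in `]a, b[ -> is_derive y (1 : R) f ((fun=> 0) y).
  by move=> yab; apply: fd; apply: subset_itv_oo_cc yab.
have fc : {within `[a, b], continuous f}.
  apply: derivable_within_continuous => y yab; have := fd y yab.
  by case.
by have [y _] := MVT_segment ab fd' fc; rewrite mul0r => /subr0_eq.
Qed.

Lemma near_is_derive0_cst (f : R -> R) (a : R) :
  (\forall z \near a, is_derive z (1 : R) f 0) -> \forall z \near a, f z = f a.
Proof.
move/nbhs_ballP => [e /= e0 he]; apply/nbhs_ballP; exists e => //= z.
rewrite /ball /= => ze; have [az|/ltW za] := leP a z; [apply/esym|];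
  apply: itv_is_derive0_cst => // y; rewrite in_itv/= => /andP[h1 h2];
  apply: he; rewrite /ball /=; move: ze.
  by rewrite !ler0_norm ?subr_le0//; lra.
by rewrite !ger0_norm ?subr_ge0//; lra.
Qed.

End PowerSeries.

(** * The generating function and its differential equation *)

Section Charlier.
Context {R : realType}.

Lemma charlier_gen_inj (x t : R) :
  is_subset1 [set c : nat -> R | charlier_gen x t c].
Proof.
move=> c d /= hc hd; apply/funext => k; apply/eqP; rewrite -subr_eq0.
have : (c k - d k) / k`!%:R = 0.
  apply: (@pseries_eq0 _ (fun k => (c k - d k) / k`!%:R)).
  apply: filterS2 hc hd => z hc hd.
  rewrite -[X in _ --> X](subrr (expR (- t * z) * (1 + z) `^ x)).
  rewrite [X in X @ _ --> _](_ : _ = pseries (fun k => c k / k`!%:R) z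
    - pseries (fun k => d k / k`!%:R) z); first exact: cvgB.
  apply/funext => n; rewrite /pseries !fctE /series /= -sumrB.
  by apply: eq_bigr => i _; rewrite !mulrBl.
by move/eqP; rewrite mulf_eq0 invr_eq0 pnatr_eq0 (gtn_eqF (fact_gt0 k)) orbF.
Qed.

(** The hypotheses are the equation (1 + z) f' = (a - b z) f read coefficient by coefficient. *)
Lemma pseries_first_order (p : nat -> R) (a b : R) :
  pseries_diffs p 0 = a * p 0%N ->
  (forall n, pseries_diffs p n.+1 + pseries_diffs p n = a * p n.+1 - b * p n) ->
  (\forall z \near (0 : R), cvgn (pseries p z)) ->
  \forall z \near (0 : R), (1 + z) * limn (pseries (pseries_diffs p) z) =
    (a - b * z) * limn (pseries p z).
Proof.
move=> p0 pS pcvg; apply: filterS2 pcvg (near_cvg_pseries_diffs _ pcvg).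
move=> z cp cd.
(* Sums multiplied by z are taken one term shorter, so both sides stop at degree N and the identity
   is exact before passing to the limit. *)
have E N : pseries (pseries_diffs p) z N.+1 +
    z * pseries (pseries_diffs p) z N =
    a * pseries p z N.+1 - b * z * pseries p z N.
  rewrite /pseries /series /=; elim: N => [|N IH].
    by rewrite !big_nat1 !big_geq// p0; ring.
  rewrite big_nat_recr//= [X in _ + z * X]big_nat_recr//=.
  rewrite [X in a * X]big_nat_recr//= [X in _ - b * z * X]big_nat_recr//=.
  set Sd := \sum_(0 <= i < N.+1) pseries_diffs p i * z ^+ i in IH *.
  set Sd' := \sum_(0 <= i < N) pseries_diffs p i * z ^+ i in IH *.
  transitivity (Sd + z * Sd' +
    (pseries_diffs p N.+1 + pseries_diffs p N) * z ^+ N.+1).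
    by rewrite exprS; ring.
  by rewrite IH pS exprS; ring.
rewrite mulrDl mul1r mulrBl.
have H1 : pseries (pseries_diffs p) z N.+1 + z * pseries (pseries_diffs p) z N
   @[N --> \oo] --> limn (pseries (pseries_diffs p) z) +
     z * limn (pseries (pseries_diffs p) z).
  apply: cvgD; first by rewrite (cvg_shiftS (pseries (pseries_diffs p) z)).
  by apply: cvgMr.
have H2 : a * pseries p z N.+1 - b * z * pseries p z N
   @[N --> \oo] --> a * limn (pseries p z) - b * z * limn (pseries p z).
  apply: cvgB; apply: cvgMr => //.
  by rewrite (cvg_shiftS (pseries p z)).
by rewrite (funext E) in H1; exact: (cvg_unique _ H1 H2).
Qed.

Lemma cvg_pseries_charlier (p : nat -> R) (x s : R) :
  p 0%N = 1 -> pseries_diffs p 0 = x - s ->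
  (forall n, pseries_diffs p n.+1 + pseries_diffs p n =
    (x - s) * p n.+1 - s * p n) ->
  (\forall z \near (0 : R), cvgn (pseries p z)) ->
  \forall z \near (0 : R), pseries p z @ \oo --> expR (- s * z) * (1 + z) `^ x.
Proof.
move=> p0 d0 dS pcvg.
have ode : \forall z \near (0 : R),
    (1 + z) * limn (pseries (pseries_diffs p) z) =
    (x - s - s * z) * limn (pseries p z).
  by apply: pseries_first_order => //; rewrite d0 p0 mulr1.
pose f z : R := limn (pseries p z).
(* Integrating factor: for 1 + z > 0 it is the reciprocal of exp(-s z) (1 + z)^x, so it suffices
   that f * E is constantly 1. *)
pose E z : R := expR (s * z - x * ln (1 + z)).
have z1 : \forall z \near (0 : R), 0 < 1 + z.
  near=> z; rewrite -ltrBlDl sub0r; near: z; apply: lt_nbhsr; lra.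
have : \forall z \near (0 : R), is_derive z (1 : R) (f * E) 0.
  near=> z.
  have z0 : 0 < 1 + z by near: z.
  have df : is_derive z (1 : R) f (limn (pseries (pseries_diffs p) z)).
    by near: z; exact: near_is_derive_pseries.
  have dE : is_derive z (1 : R) E (E z * (s - x * (1 + z)^-1)).
    have dl : is_derive z (1 : R) (fun y => 1 + y) 1.
      have := @is_deriveD R R R (cst 1) id z 1 0 1
        (is_derive_cst (1 : R) z 1) (is_derive_id z 1).
      by rewrite add0r.
    have ds := @is_deriveZ R R R id s z 1 1 (is_derive_id z 1).
    have dln := @is_deriveZ R R R _ x z 1 _
      (is_derive1_comp (is_derive1_ln z0) dl).
    have := is_derive1_comp (is_derive_expR _) (is_deriveB ds dln).
    by rewrite /GRing.scale /= !mulr1.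
  apply: is_derive_eq; rewrite /GRing.scale /=.
  have : (1 + z) * limn (pseries (pseries_diffs p) z) =
    (x - s - s * z) * limn (pseries p z) by near: z.
  set d := limn (pseries (pseries_diffs p) z); rewrite -/(f z) => h.
  have -> : d = (x - s - s * z) * f z / (1 + z).
    by rewrite -h mulrAC mulfV ?mul1r// gt_eqF.
  by field; rewrite gt_eqF.
move/near_is_derive0_cst; apply: filter_app; apply: filter_app z1.
apply: filterS pcvg => z cz z0.
have -> : (f * E) 0 = 1.
  rewrite !fctE /f /E limn_pseries0 p0 mulr0 addr0 ln1 mulr0 subr0 expR0.
  by rewrite mulr1.
rewrite !fctE /E => fE.
suff <- : f z = expR (- s * z) * (1 + z) `^ x by exact: cz.
rewrite /powR gt_eqF// -expRD.
have -> : - s * z + x * ln (1 + z) = - (s * z - x * ln (1 + z)) by ring.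
have E0 := lt0r_neq0 (expR_gt0 (s * z - x * ln (1 + z))).
by apply: (mulIf E0); rewrite expRN mulVf.
Unshelve. all: by end_near. Qed.

(** The recursion for the evaluated polynomials, which frees the analysis from the polynomial
    ring. *)
Definition kailath_segall_recursion (p v : nat -> R) : Prop :=
  forall n, p n.+1 =
    n.+1%:R^-1 * \sum_(i < n.+1) (-1) ^+ i * (p (n - i)%N * v i.+1).

(* Adding two consecutive instances of the recursion telescopes the alternating
   sums, because all the v_i with i >= 2 coincide. *)
Lemma kailath_segall_diffs_rec (p v : nat -> R) (y : R) :
  (forall i, v i.+2 = y) -> kailath_segall_recursion p v ->
  forall n, pseries_diffs p n.+1 + pseries_diffs p n =
    v 1%N * p n.+1 + (v 1%N - y) * p n.
Proof.
move=> vy pS.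
have dE n : pseries_diffs p n =
    \sum_(i < n.+1) (-1) ^+ i * (p (n - i)%N * v i.+1).
  by rewrite /pseries_diffs pS mulVKf// pnatr_eq0.
move=> n; rewrite !dE.
rewrite big_ord_recl [X in _ + X]big_ord_recl big_ord_recl /= !expr0 !subn0.
rewrite /bump /= !add1n subSS subn0 expr1 vy.
(* What remains are the tails from [v 3] on in the first sum and from [v 2] on in the second; they
   are opposite term by term. *)
rewrite [X in _ + (_ + X) + _](_ : _ =
  - \sum_(i < n) (-1) ^+ (bump 0 i) * (p (n - bump 0 i)%N * v (bump 0 i).+1)).
  rewrite /bump; ring.
rewrite -sumrN; apply: eq_bigr => i _.
by rewrite /bump /= !add1n subSS !vy [in LHS]exprS; ring.
Qed.

(** Strong induction: each of the n + 1 summands is at most M^n * M, since M^(n-i) <= M^n for M >=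
    1, and the prefactor 1 / (n + 1) cancels their number. *)
Lemma kailath_segall_bound (p v : nat -> R) (M : R) : 1 <= M ->
  (forall i, `|v i| <= M) -> p 0%N = 1 ->
  kailath_segall_recursion p v ->
  forall n, `|p n| <= M ^+ n.
Proof.
move=> M1 vM p0 pS; have M0 : 0 <= M by rewrite (le_trans _ M1).
elim/ltn_ind => -[_|n IH]; first by rewrite p0 normr1.
rewrite pS normrM normfV normr_nat ler_pdivrMl//.
apply: (le_trans (ler_norm_sum _ _ _)).
have -> : n.+1%:R * M ^+ n.+1 = \sum_(i < n.+1) M ^+ n * M.
  by rewrite sumr_const card_ord exprSr mulr_natl.
apply: ler_sum => i _; rewrite !normrM normrX normrN1 expr1n mul1r.
apply: ler_pM => //; apply: (le_trans (IH _ _)); first by rewrite ltnS leq_subr.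
by rewrite ler_weXn2l// leq_subr.
Qed.

Lemma charlier_gen_kailath_segall (p : nat -> R) (x s : R) : p 0%N = 1 ->
  kailath_segall_recursion p (fun i => if i == 1%N then x - s else x) ->
  charlier_gen x s (fun n => n`!%:R * p n).
Proof.
move=> p0 pS.
pose M := 1 + `|x - s| + `|x|.
have M1 : 1 <= M by rewrite /M -addrA lerDl addr_ge0.
have vM i : `|if i == 1%N then x - s else x| <= M.
  rewrite /M; case: eqP => _; last by rewrite lerDr addr_ge0.
  by rewrite addrAC lerDr addr_ge0.
have pcvg : \forall z \near (0 : R), cvgn (pseries p z).
  apply: (@near_cvg_pseries _ _ 1 M) => n; rewrite mul1r.
  exact: kailath_segall_bound vM p0 pS n.
rewrite /charlier_gen (_ : (fun n => n`!%:R * p n / n`!%:R) = p); last first.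
  by apply/funext => n; rewrite mulrC mulKf// pnatr_eq0 gtn_eqF// fact_gt0.
apply: cvg_pseries_charlier => //.
  by rewrite /pseries_diffs mul1r pS big_ord1 /= p0 !mul1r invr1 mul1r.
(* Here [v 1 - y] is (x - s) - x = -s, the coefficient needed for the differential equation. *)
have dS := kailath_segall_diffs_rec _ _ x (fun=> erefl) pS.
by move=> n; rewrite dS /=; ring.
Qed.

End Charlier.

Theorem mainTheorem2 (R : realType) (x t lambda : R)
    (ht : 0 <= t) (hlambda : 0 < lambda) (k : nat) :
  k`!%:R *
    infpoly_eval (fun i => if i == 1%N then x - lambda * t else x)
      (kailath_segall R k)
  = poisson_charlier k x (lambda * t).
Proof.
set v := fun i => _.
(* The default of [xget] is ruled out by exhibiting a sequence with the right generating function;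
   uniqueness makes it the chosen one. *)
rewrite /poisson_charlier (@xget_subset1 _ _ _
  (fun n => n`!%:R * infpoly_eval v (kailath_segall R n))) //;
  last exact: charlier_gen_inj.
apply: charlier_gen_kailath_segall; first exact: infpoly_eval_kailath_segall0.
by move=> n; exact: infpoly_eval_kailath_segallS.
Qed.
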